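(* Let $M\in R^{n,n}$ be a matrix of rank $n-1$. Let $\gamma(M)=(g_1,\ldots,g_n)$, $\gamma(M^T)=(h_1,\ldots,h_n)$, and let $J$ be the ideal generated by the components of $\gamma(M^T)$. Let $M^C$ be the cofactor matrix of $M$. Then $M$ is a presentation matrix if and only if $\operatorname{depth} J\ge 3$ and $M^C=u\,(g_ih_j)_{i,j}$ where $u\in R$ is a unit.
   Context: $k$ is a field, $R=k[x_1,\ldots,x_r]$, $r\ge 3$, and $n\ge 3$. $R^{n,m}$ denotes the $n\times m$ matrices over $R$. A matrix $M\in R^{n,n}$ is called a presentation matrix if it is the matrix of a map $\varphi$ in an exact sequence $R^n\xrightarrow{\varphi}R^n\to R$ (exact at the middle term). The depth of an ideal is its grade, i.e. the maximal length of an $R$-regular sequence contained in it (infinite for the unit ideal). The cofactor matrix $M^C=(c_{ij})$ has as entry $c_{ij}$ the cofactor of $M$ at position $(i,j)$. For $N\in R^{n,n-1}$ put $g_i(N)=(-1)^{i+1}N_i$, where $N_i$ is the minor of $N$ obtained by deleting the $i$-th row. For $M\in R^{n,n}$ with $\operatorname{rank} M=n-1$, choose $n-1$ columns of $M$ forming a submatrix $N$ of rank $n-1$, let $d_N=\gcd(g_1(N),\ldots,g_n(N))$, and set $\gamma(M)=(g_1(N)/d_N,\ldots,g_n(N)/d_N)$. This vector is independent of the choice of $N$ up to multiplication by a unit. *)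

(* Defs.v *)
From mathcomp Require Import all_boot all_algebra.
From mathcomp Require Export mpoly.

Set Implicit Arguments.
Unset Strict Implicit.
Unset Printing Implicit Defensive.

Import GRing.Theory.
Local Open Scope ring_scope.

Definition gen_ideal (R : comNzRingType) (s : seq R) (x : R) : Prop :=
  exists c : 'I_(size s) -> R, x = \sum_(i < size s) c i * s`_i.

(* Each term is a nonzerodivisor modulo the ideal of the previous ones, and
   the quotient by the whole sequence is nonzero. *)
Definition regular_seq (R : comNzRingType) (s : seq R) : Prop :=
  (forall i : nat, (i < size s)%N ->
     forall x : R, gen_ideal (take i s) (s`_i * x) -> gen_ideal (take i s) x)
  /\ ~ gen_ideal s 1.

(* d <= depth I.  The depth is the supremum of the lengths of the regular
   sequences in I, and is infinite when I is the unit ideal. *)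
Definition depth_ge (R : comNzRingType) (I : R -> Prop) (d : nat) : Prop :=
  I 1 \/
  exists s : seq R,
    [/\ regular_seq s, (d <= size s)%N & forall x : R, x \in s -> I x].

Definition dvdr (R : comNzRingType) (a b : R) : Prop :=
  exists q : R, b = q * a.

(* A gcd is only defined up to a unit, hence a relation. *)
Definition is_gcd (R : comNzRingType) (m : nat) (a : 'I_m -> R) (d : R) : Prop :=
  (forall i, dvdr d (a i)) /\
  (forall e : R, (forall i, dvdr e (a i)) -> dvdr e d).

Definition frac_rank (R : idomainType) (m n : nat) (M : 'M[R]_(m, n)) : nat :=
  \rank (map_mx (@FracField.tofrac R) M).

(* With 0-based indices the sign (-1)^(i+1) becomes (-1)^i. *)
Definition signed_minor (R : comNzRingType) (n : nat) (N : 'M[R]_(n, n.-1))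
    (i : 'I_n) : R :=
  (-1) ^+ i * \det (row' i N).

(* g is a value of gamma(M), which is determined up to a unit.  Choosing n - 1
   of the n columns of M means deleting one of them, say the j-th. *)
Definition is_gamma (R : idomainType) (n : nat) (M : 'M[R]_n) (g : 'rV[R]_n)
    : Prop :=
  exists (j : 'I_n) (d : R),
    let N := col' j M in
    [/\ frac_rank N = n.-1,
        is_gcd (signed_minor N) d
      & forall i, signed_minor N i = g 0 i * d].

(* M acts on column vectors.  R^o is R as a module over itself. *)
Definition presentation_matrix (R : comNzRingType) (n : nat) (M : 'M[R]_n)
    : Prop :=
  exists psi : {linear 'cV[R]_n -> R^o},
    forall v : 'cV[R]_n, psi v = 0 <-> exists w : 'cV[R]_n, v = M *m w.

Definition cofactor_mx (R : comNzRingType) (n : nat) (M : 'M[R]_n) : 'M[R]_n :=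
  \matrix_(i, j) cofactor M i j.

(* Main.v *)
From HB Require Import structures.
Require Import Defs.
From mathcomp Require Import all_boot all_algebra ring zify.
From Stdlib Require Import ClassicalEpsilon.

Set Implicit Arguments.
Unset Strict Implicit.
Unset Printing Implicit Defensive.

Import GRing.Theory.
Local Open Scope ring_scope.

(** Let [g] and [h] stand for [gamma M] and [gamma M^T].  They generate the left
    and the right kernel of [M], so there is a complex
    [0 -> R -> R^n -> R^n -> R] with maps [h], [M], [g], and every linear form
    that vanishes on the columns of [M] is a multiple of [g].  Hence [M] is a
    presentation matrix exactly when this complex is exact at the second [R^n]
    ([presentation_matrixP]).  Rows and columns of the cofactor matrix lie in
    the two kernels, so the cofactor matrix is always [a * g_i * h_j] for some
    [a] in [R] ([cofactor_rank_one]).  The theorem is then the criterion of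
    Buchsbaum and Eisenbud for this complex, proved here by hand.

    Assume that [a] is a unit and that [J] has depth at least 3, and let
    [g *m v = 0].  Cramer's rule and the primitivity of [g] put each [h_j *: v],
    hence [J *: v], into the image of [M] ([kernel_scaled_in_image]).  A descent
    along a regular sequence of length 3 in [J] puts [v] itself into the image
    ([image_descent]); the third element of the sequence is what makes
    solutions for the first two compatible.

    Assume conversely exactness.  For each [i] the matrix [g_i *: 1 - e_i *m g]
    factors through [M], and comparing cofactors shows that [a] divides a power
    of each [g_i], so that [a] is a unit ([cofactor_factor_unit]).  Moreover, if
    [a1, a2] is a regular sequence in [J], then no nonzero element modulo
    [(a1, a2)] is annihilated by [J] ([kernel_ideal_faithful]).  As [R] is
    noetherian, an ideal that annihilates no nonzero element contains a
    nonzerodivisor ([exists_nonzerodivisor_mod]), which prolongs the sequence to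
    length 3 unless [J] is the unit ideal ([exact_depth_ge3]).

    Two facts on polynomial rings over a field are used: they are noetherian
    ([hilbert_basis]), and any two elements have a greatest common divisor
    ([has_gcds_poly]).  The latter makes a vector with gcd 1 primitive in the
    strong sense of [primitive] below, the only form in which unique
    factorization enters. *)

(** * Ideals and noetherian rings *)

Lemma ex_minimal (T : Type) (P : T -> Prop) (f : T -> nat) :
  (exists x, P x) -> exists2 x, P x & forall y, P y -> (f x <= f y)%N.
Proof.
case=> x Px; have [m] := ubnP (f x); elim: m x Px => // m IHm x Px lt_m.
have [[y [Py lt_yx]]|no_smaller] :=
  classic (exists y, P y /\ (f y < f x)%N).
  by apply: (IHm y) => //; apply: leq_trans lt_yx _.
exists x => // y Py; rewrite leqNgt; apply/negP => lt_yx.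
by apply: no_smaller; exists y.
Qed.

Section Ideals.
Variable R : comNzRingType.
Implicit Types (s t : seq R) (x y a b c : R) (I J : R -> Prop).

Definition is_ideal I := I 0 /\ forall c x y, I x -> I y -> I (c * x + y).

Lemma ideal0 I : is_ideal I -> I 0. Proof. by case. Qed.

Lemma idealM I c x : is_ideal I -> I x -> I (c * x).
Proof. by case=> I0 Il Ix; rewrite -[c * x]addr0; apply: Il. Qed.

Lemma idealD I x y : is_ideal I -> I x -> I y -> I (x + y).
Proof. by case=> I0 Il Ix Iy; rewrite -[x]mul1r; apply: Il. Qed.

Lemma idealN I x : is_ideal I -> I x -> I (- x).
Proof. by move=> idI Ix; rewrite -mulN1r; apply: idealM. Qed.

Lemma gen_ideal_nil x : gen_ideal [::] x <-> x = 0.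
Proof.
split=> [[c ->]|->]; first by rewrite big_ord0.
by exists (fun=> 0); rewrite big_ord0.
Qed.

Lemma gen_ideal_cons a s x :
  gen_ideal (a :: s) x <-> exists c y, gen_ideal s y /\ x = c * a + y.
Proof.
split=> [[c ->]|[c [_ [[d ->] ->]]]].
  rewrite big_ord_recl /=; exists (c ord0); eexists; split; last by [].
  by exists (fun i => c (lift ord0 i)).
exists (fun i => oapp d c (unlift ord0 i)).
rewrite /= big_ord_recl unlift_none /=; congr (_ + _).
by apply: eq_bigr => i _; rewrite liftK.
Qed.

Lemma gen_ideal_is_ideal s : is_ideal (gen_ideal s).
Proof.
split=> [|c x y]; first by exists (fun=> 0); rewrite big1 // => i _; rewrite mul0r.
case=> d -> [e ->]; exists (fun i => c * d i + e i).
rewrite mulr_sumr -big_split /=; apply: eq_bigr => i _.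
by rewrite mulrDl mulrA.
Qed.

Lemma gen_ideal0 s : gen_ideal s 0.
Proof. exact: ideal0 (gen_ideal_is_ideal s). Qed.

Lemma gen_ideal_mem s x : x \in s -> gen_ideal s x.
Proof.
elim: s => // a s IHs; rewrite inE => /orP [/eqP->|xs]; apply/gen_ideal_cons.
  by exists 1, 0; rewrite mul1r addr0; split=> //; exact: gen_ideal0.
by exists 0, x; rewrite mul0r add0r; split=> //; apply: IHs.
Qed.

Lemma gen_ideal_min I s :
  is_ideal I -> (forall x, x \in s -> I x) -> forall x, gen_ideal s x -> I x.
Proof.
move=> idI; elim: s => [|a s IHs] sI x.
  by move/gen_ideal_nil->; apply: ideal0.
case/gen_ideal_cons=> c [y [sy ->]].
apply: idealD => //; first by apply: idealM => //; apply: sI; rewrite mem_head.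
by apply: IHs => // z zs; apply: sI; rewrite inE zs orbT.
Qed.

Lemma gen_ideal_sub s t :
  {subset s <= t} -> forall x, gen_ideal s x -> gen_ideal t x.
Proof.
move=> st; apply: gen_ideal_min; first exact: gen_ideal_is_ideal.
by move=> x /st; apply: gen_ideal_mem.
Qed.

Lemma gen_ideal1 a x : gen_ideal [:: a] x <-> dvdr a x.
Proof.
split=> [/gen_ideal_cons [c [_ [/gen_ideal_nil -> ->]]]|[c ->]].
  by exists c; rewrite addr0.
by apply/gen_ideal_cons; exists c, 0; rewrite addr0; split=> //; apply/gen_ideal_nil.
Qed.

Lemma gen_ideal2 a b x :
  gen_ideal [:: a; b] x <-> exists c d, x = c * a + d * b.
Proof.
split=> [/gen_ideal_cons [c [_ [/gen_ideal1 [d ->] ->]]]|[c [d ->]]].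
  by exists c, d.
by apply/gen_ideal_cons; exists c, (d * b); split=> //; apply/gen_ideal1; exists d.
Qed.

End Ideals.

Definition noetherian (R : comNzRingType) :=
  forall I : R -> Prop, is_ideal I ->
    exists s : seq R, forall x, I x <-> gen_ideal s x.

Section Noetherian.
Variables (R : comNzRingType) (noethR : noetherian R).

(** Otherwise a counterexample [s] could be extended forever by elements
    outside the ideal generated so far, and the union of these ideals would not
    be finitely generated. *)
Lemma noetherian_ind (Q : seq R -> Prop) :
  (forall s, (forall x, ~ gen_ideal s x -> Q (x :: s)) -> Q s) -> forall s, Q s.
Proof.
move=> stepQ s0; apply: NNPP => nQ0.
have next (u : {s | ~ Q s}) :
    {x | ~ gen_ideal (sval u) x /\ ~ Q (x :: sval u)}.
  apply: constructive_indefinite_description; case: u => s nQ /=.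
  apply: NNPP => no_x; apply: nQ; apply: stepQ => x nsx.
  by apply: NNPP => nQx; apply: no_x; exists x.
pose grow u : {s | ~ Q s} :=
  exist (fun s => ~ Q s) (sval (next u) :: sval u) (proj2 (svalP (next u))).
pose u m := iter m grow (exist (fun s => ~ Q s) s0 nQ0).
have u_sub m p : (m <= p)%N -> {subset sval (u m) <= sval (u p)}.
  elim: p => [|p IHp]; first by rewrite leqn0 => /eqP->.
  rewrite leq_eqVlt => /orP [/eqP-> //|]; rewrite ltnS => /IHp sub x /sub xu.
  by rewrite /= inE xu orbT.
pose I x := exists m, gen_ideal (sval (u m)) x.
have idI : is_ideal I.
  split=> [|c x y [m mx] [p py]]; first by exists 0%N; exact: gen_ideal0.
  exists (maxn m p); apply: (proj2 (gen_ideal_is_ideal _)).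
    exact: gen_ideal_sub (u_sub _ _ (leq_maxl m p)) _ mx.
  exact: gen_ideal_sub (u_sub _ _ (leq_maxr m p)) _ py.
have [t It] := noethR idI.
have [m tm] : exists m, forall x, x \in t -> gen_ideal (sval (u m)) x.
  have: forall x, x \in t -> I x by move=> x xt; apply/It; apply: gen_ideal_mem.
  elim: (t) => [|a l IHl] lI; first by exists 0%N.
  have [|m lm] := IHl; first by move=> x xl; apply: lI; rewrite inE xl orbT.
  have [p ap] := lI a (mem_head _ _); exists (maxn m p) => x.
  rewrite inE => /orP [/eqP->|xl].
    exact: gen_ideal_sub (u_sub _ _ (leq_maxr m p)) _ ap.
  exact: gen_ideal_sub (u_sub _ _ (leq_maxl m p)) _ (lm x xl).
have [nm _] := svalP (next (u m)); apply: nm.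
apply: (gen_ideal_min (gen_ideal_is_ideal _) tm); apply/It.
by exists m.+1; apply: gen_ideal_mem; rewrite /= mem_head.
Qed.

(** Multiplication by powers of ['X] aligns the leading terms of the generators
    in degree [N.-1], where a relation between leading coefficients is realized
    by a polynomial. *)
Lemma gen_ideal_lead_coef (t : seq {poly R}) (N : nat) (a : R) :
  (forall f, f \in t -> (size f <= N)%N) -> gen_ideal (map lead_coef t) a ->
  exists f, [/\ gen_ideal t f, (size f <= N)%N & f`_N.-1 = a].
Proof.
elim: t a => [|p t IHt] a tN /=.
  move/gen_ideal_nil->; exists 0; rewrite size_poly0 coef0.
  by split=> //; apply/gen_ideal_nil.
case/gen_ideal_cons=> c [y [ty ->]].
have [|f [tf fN fy]] := IHt y _ ty.
  by move=> g gt; apply: tN; rewrite inE gt orbT.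
have pN : (size p <= N)%N by apply: tN; rewrite mem_head.
exists ((c%:P * 'X^(N - size p)) * p + f); split.
- by apply/gen_ideal_cons; exists (c%:P * 'X^(N - size p)), f.
- rewrite (leq_trans (size_polyD _ _)) // geq_max fN andbT.
  rewrite -mulrA mul_polyC (leq_trans (size_scale_leq _ _)) //.
  by rewrite (leq_trans (size_polyMleq _ _)) // size_polyXn addSn /= subnK.
- rewrite coefD fy -mulrA coefCM mulrC ['X^_ * p]mulrC coefMXn.
  have [->|p_neq0] := eqVneq p 0.
    by rewrite coef0 if_same lead_coef0 mul0r mulr0.
  have p_gt0 : (0 < size p)%N by rewrite size_poly_gt0.
  rewrite ifF; last by lia.
  by rewrite lead_coefE mulrC; congr (_ * p`__ + _); lia.
Qed.

(** Generators are added greedily, each of least degree among the elements of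
    the ideal not yet generated.  The new leading coefficient is then outside
    the ideal of the earlier ones, for otherwise an earlier combination could
    be subtracted to lower the degree; so the process terminates. *)
Theorem hilbert_basis : noetherian {poly R}.
Proof.
move=> I idI.
have grow : forall l : seq R, forall t : seq {poly R},
    map lead_coef t = l -> (forall f, f \in t -> I f) ->
    (forall f q, f \in t -> I q -> ~ gen_ideal t q -> (size f <= size q)%N) ->
    exists s, forall x, I x <-> gen_ideal s x.
  elim/noetherian_ind=> l IHl t lt tI t_min.
  have [new|old] := classic (exists q, I q /\ ~ gen_ideal t q); last first.
    exists t => x; split; last exact: gen_ideal_min.
    by move=> Ix; apply: NNPP => ntx; apply: old; exists x.
  have [p [Ip ntp] p_min] := ex_minimal (fun q : {poly R} => size q) new.
  apply: (IHl (lead_coef p) _ (p :: t)) => /=; last first.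
  - move=> f q; rewrite inE => /orP [/eqP->|ft] Iq nq.
      apply: p_min; split=> // tq; apply: nq; apply/gen_ideal_cons.
      by exists 0, q; rewrite mul0r add0r.
    apply: t_min => // tq; apply: nq; apply/gen_ideal_cons.
    by exists 0, q; rewrite mul0r add0r.
  - by move=> f; rewrite inE => /orP [/eqP->|/tI].
  - by rewrite lt.
  rewrite -lt => /(gen_ideal_lead_coef (N := size p)) [f ft|f [tf f_size f_lead]].
    exact: t_min.
  have p_neq0 : p != 0.
    by apply/eqP => p0; apply: ntp; rewrite p0; apply: gen_ideal0.
  have tpf : gen_ideal t (p - f).
    apply: NNPP => npf; have: (size p <= size (p - f)%R)%N.
      apply: p_min; split=> //; apply: idealD => //; apply: idealN => //.
      exact: gen_ideal_min tf.
    rewrite leqNgt => /negP; apply.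
    have: (size (p - f)%R <= size p)%N.
      by rewrite (leq_trans (size_polyD _ _)) // size_polyN geq_max leqnn.
    rewrite leq_eqVlt => /orP [/eqP size_pf|//].
    suff: lead_coef (p - f) == 0.
      rewrite lead_coef_eq0 => /eqP pf0; move: p_neq0.
      by rewrite -size_poly_gt0 -size_pf pf0 size_poly0.
    by rewrite lead_coefE size_pf coefB f_lead subrr.
  apply: ntp; rewrite -[p](subrK f); apply: idealD => //.
  exact: gen_ideal_is_ideal.
exact: (grow [::] [::]).
Qed.

(** The annihilator ideal [(I : s)] is maximal among those of the elements
    outside [I], i.e. among the proper annihilators of elements of [R / I]. *)
Definition maximal_annihilator (I : R -> Prop) (s : R) : Prop :=
  ~ I s /\ forall s', ~ I s' -> (forall x, I (s * x) -> I (s' * x)) ->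
    forall x, I (s' * x) -> I (s * x).

Section Avoidance.
Variables (I : R -> Prop) (idI : is_ideal I).

Lemma maximal_annihilator_exists s : ~ I s ->
  exists2 s', maximal_annihilator I s' & forall x, I (s * x) -> I (s' * x).
Proof.
suff below : forall (t : seq R) s, ~ I s -> (forall x, x \in t -> I (s * x)) ->
    exists2 s', maximal_annihilator I s' & forall x, I (s * x) -> I (s' * x).
  by move=> nIs; apply: (below [::]).
elim/noetherian_ind=> t IHt {}s nIs st.
have [max_s|] := classic (maximal_annihilator I s); first by exists s.
move=> not_max; have [s' [x [nIs' sub nsx s'x]]] : exists s' x,
    [/\ ~ I s', forall y, I (s * y) -> I (s' * y), ~ I (s * x) & I (s' * x)].
  apply: NNPP => none; apply: not_max; split=> // s' nIs' sub x s'x.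
  by apply: NNPP => nsx; apply: none; exists s', x.
have [||s'' max_s'' sub'] := IHt x _ s' nIs'.
- move=> tx; apply: nsx; move: x tx {s'x}; apply: gen_ideal_min => //.
  split=> [|c y z sy sz]; first by rewrite mulr0; apply: ideal0.
  by rewrite mulrDr mulrCA; apply: (proj2 idI).
- by move=> y; rewrite inE => /orP [/eqP->|/st/sub].
- by exists s'' => // y /sub/sub'.
Qed.

Lemma maximal_annihilator_prime s a b : maximal_annihilator I s ->
  I (s * (a * b)) -> ~ I (s * a) -> I (s * b).
Proof.
case=> nIs max_s sab nsa; apply: (max_s (s * a)) => //; last by rewrite -mulrA.
by move=> x sx; rewrite mulrAC mulrC; apply: idealM.
Qed.

(** Prime avoidance over the maximal annihilators: as long as the current
    element of [J] is a zero divisor modulo [I], it lies in a further maximal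
    annihilator [(I : s)]; this is corrected by adding an [y] in [J], outside
    [(I : s)], which kills all the earlier witnesses.  Such an [y] also shows
    that [s] is outside the ideal of the earlier witnesses, so that the process
    terminates. *)
Theorem exists_nonzerodivisor_mod (J : R -> Prop) : is_ideal J ->
  (forall s, (forall x, J x -> I (s * x)) -> I s) ->
  exists2 a, J a & forall s, I (a * s) -> I s.
Proof.
move=> idJ faithful.
suff from : forall (ss : seq R) x, (forall s, s \in ss -> maximal_annihilator I s) ->
    J x -> (forall s, s \in ss -> ~ I (s * x)) ->
    exists2 a, J a & forall s, I (a * s) -> I s.
  by apply: (from [::] 0) => //; apply: ideal0.
elim/noetherian_ind=> ss IHss x max_ss Jx avoid_x.
have [?|not_regular] := classic (forall s, I (x * s) -> I s); first by exists x.
have [s0 [xs0 nIs0]] : exists s0, I (x * s0) /\ ~ I s0.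
  apply: NNPP => none; apply: not_regular => s xs.
  by apply: NNPP => nIs; apply: none; exists s.
have [s max_s s0s] := maximal_annihilator_exists nIs0.
have sx : I (s * x) by apply: s0s; rewrite mulrC.
have [y [Jy ss_y nsy]] : exists y,
    [/\ J y, forall s', s' \in ss -> I (s' * y) & ~ I (s * y)].
  have: forall s', s' \in ss -> maximal_annihilator I s' /\ ~ I (s' * x).
    by move=> s' ss'; split; [apply: max_ss|apply: avoid_x].
  elim: (ss) => [|s' l IHl] max_l.
    apply: NNPP => none; apply: (proj1 max_s); apply: faithful => y Jy.
    by apply: NNPP => nsy; apply: none; exists y.
  have [|y [Jy l_y nsy]] := IHl.
    by move=> s'' ls''; apply: max_l; rewrite inE ls'' orbT.
  have [max_s' ns'x] := max_l s' (mem_head _ _).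
  have [z [s'z nsz]] : exists z, I (s' * z) /\ ~ I (s * z).
    apply: NNPP => none; apply: ns'x.
    apply: (proj2 max_s' s (proj1 max_s) _ _ sx) => z s'z.
    by apply: NNPP => nsz; apply: none; exists z.
  exists (z * y); split; first exact: idealM.
    move=> s''; rewrite inE => /orP [/eqP->|/l_y s''y].
      by rewrite mulrA mulrC; apply: idealM.
    by rewrite mulrCA; apply: idealM.
  by move=> szy; apply: nsy; apply: maximal_annihilator_prime szy nsz.
apply: (IHss s _ (x + y)).
- move=> ss_s; apply: nsy.
  move: (s) ss_s; apply: gen_ideal_min => //.
  split=> [|c a b ay by_]; first by rewrite mul0r; apply: ideal0.
  by rewrite mulrDl -mulrA; apply: (proj2 idI).
- by move=> s'; rewrite inE => /orP [/eqP->|/max_ss].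
- exact: idealD.
- move=> s'; rewrite inE mulrDr => /orP [/eqP->|ss'] s'xy.
    apply: nsy; rewrite -[s * y](addKr (s * x)).
    by apply: idealD => //; apply: idealN.
  apply: (avoid_x s') => //; rewrite -[s' * x](addrK (s' * y)).
  by apply: idealD => //; apply: idealN => //; apply: ss_y.
Qed.

End Avoidance.
End Noetherian.

Lemma noetherian_field (k : fieldType) : noetherian k.
Proof.
move=> I idI; have [[a [Ia a0]]|zero] := classic (exists a, I a /\ a <> 0).
  have aV : a^-1 * a = 1 by rewrite mulVf //; apply/eqP.
  exists [:: a] => x; rewrite gen_ideal1; split=> [_|[q ->]]; last exact: idealM.
  by exists (x * a^-1); rewrite -mulrA aV mulr1.
exists [::] => x; rewrite gen_ideal_nil; split=> [Ix|->]; last exact: ideal0.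
by apply: NNPP => x0; apply: zero; exists x.
Qed.

Lemma noetherian_surj (S T : comNzRingType) (f : {rmorphism S -> T}) :
  (forall y, exists x, f x = y) -> noetherian S -> noetherian T.
Proof.
move=> f_surj noethS I idI; have [|s Is] := noethS (fun x => I (f x)).
  split=> [|c x y Ix Iy]; first by rewrite rmorph0; apply: ideal0.
  by rewrite rmorphD rmorphM; apply: (proj2 idI).
exists (map f s) => y; split; last first.
  apply: gen_ideal_min => // _ /mapP [x xs ->]; apply/Is.
  exact: gen_ideal_mem.
have [x <-] := f_surj y; move/Is; move: x; apply: gen_ideal_min.
  split=> [|c x z Ix Iz]; first by rewrite rmorph0; apply: gen_ideal0.
  by rewrite rmorphD rmorphM; apply: (proj2 (gen_ideal_is_ideal _)).
by move=> x xs; apply: gen_ideal_mem; apply: map_f.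
Qed.

(** * Divisibility in domains with greatest common divisors *)

Section Divisibility.
Variable R : comNzRingType.
Implicit Types a b c : R.

Lemma dvdr_refl a : dvdr a a. Proof. by exists 1; rewrite mul1r. Qed.

Lemma dvdr0 a : dvdr a 0. Proof. by exists 0; rewrite mul0r. Qed.

Lemma dvdr_trans b a c : dvdr a b -> dvdr b c -> dvdr a c.
Proof. by move=> [q ->] [p ->]; exists (p * q); rewrite mulrA. Qed.

Lemma dvdr_mull a b c : dvdr a b -> dvdr a (c * b).
Proof. by move=> [q ->]; exists (c * q); rewrite mulrA. Qed.

Lemma dvdr_mulr a b c : dvdr a b -> dvdr a (b * c).
Proof. by rewrite mulrC; apply: dvdr_mull. Qed.

Lemma dvdrD a b c : dvdr a b -> dvdr a c -> dvdr a (b + c).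
Proof. by move=> [q ->] [p ->]; exists (q + p); rewrite mulrDl. Qed.

Lemma dvdrB a b c : dvdr a b -> dvdr a c -> dvdr a (b - c).
Proof. by move=> [q ->] [p ->]; exists (q - p); rewrite mulrBl. Qed.

Lemma dvdr_sum (I : finType) (P : pred I) (F : I -> R) a :
  (forall i, P i -> dvdr a (F i)) -> dvdr a (\sum_(i | P i) F i).
Proof.
move=> aF; elim/big_ind: _ => //; first exact: dvdr0.
by move=> x y; apply: dvdrD.
Qed.

(** A form of coprimality that survives scaling: for every [q], no nonzero
    element of [R / q] is annihilated by all [g i].  In a domain with gcds it
    amounts to having gcd 1. *)
Definition primitive (I : Type) (g : I -> R) : Prop :=
  forall q p, (forall i, dvdr q (p * g i)) -> dvdr q p.

(** The exponents may be lowered one at a time: if all of them are positive,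
    then [a] divides every [(z * g j) * g i ^+ e' i] with [e'] equal to [e]
    except for [e' j = e j - 1]. *)
Lemma primitive_pow (I : finType) (g : I -> R) (e : I -> nat) a z :
  primitive g -> (forall i, dvdr a (z * g i ^+ e i)) -> dvdr a z.
Proof.
move=> prim_g; have [m] := ubnP (\sum_i e i).
elim: m e z => // m IHm e z lt_m az.
have [/existsP [i /eqP ei0]|/existsPn pos] := boolP [exists i, e i == 0%N].
  by move: (az i); rewrite ei0 expr0 mulr1.
apply: prim_g => j; pose e' i := if i == j then (e i).-1 else e i.
apply: (IHm e') => [|i].
  have ej : e j = (e' j).+1 by rewrite /e' eqxx prednK // lt0n pos.
  move: lt_m; rewrite (bigD1 j) //= ej addSn ltnS; apply: leq_trans.
  rewrite (bigD1 j) //= ltnS leq_add2l; apply: leq_sum => i /negbTE.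
  by rewrite /e' => ->.
rewrite /e'; case: eqP => [->|_]; last by rewrite mulrAC; apply: dvdr_mulr.
by rewrite -mulrA -exprS prednK // lt0n pos.
Qed.

End Divisibility.

(** Modulo [r] this is McCoy's theorem: a zero divisor in a polynomial ring is
    annihilated by a nonzero constant.  Here it gives Gauss's lemma in a form
    that needs no factorization. *)
Lemma primitive_poly_dvdr (R : comNzRingType) (f h : {poly R}) (r : R) :
  primitive (fun i : nat => f`_i) -> dvdr r%:P (f * h) -> dvdr r%:P h.
Proof.
move=> prim_f.
have divC (p : {poly R}) : (forall i, dvdr r p`_i) -> dvdr r%:P p.
  move=> rp; have [q qE] := fin_all_exists (fun i : 'I_(size p) => rp i).
  exists (\poly_(i < size p) oapp q 0 (insub i)); apply/polyP => i.
  rewrite coefMC coef_poly; case: insubP => [j -> <-|] /=; first exact: qE.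
  by rewrite -leqNgt => ge_i; rewrite nth_default // if_same mul0r.
have coef_div (p : {poly R}) i : dvdr r%:P p -> dvdr r p`_i.
  by case=> q ->; exists q`_i; rewrite coefMC.
have [m] := ubnPleq (size h); elim: m h => [|m IHm] h h_size r_fh.
  have -> : h = 0 by apply/eqP; rewrite -size_poly_leq0.
  exact: dvdr0.
(* Once [r] divides the top coefficient of a multiple of [h], the induction
   hypothesis applies to what remains of this multiple. *)
have from_top c : dvdr r (c * h`_m) -> dvdr r%:P (c *: h).
  move=> r_chm.
  have r_top : dvdr r%:P ((c * h`_m) *: 'X^m).
    by apply: divC => i; rewrite coefZ; apply: dvdr_mulr.
  rewrite -[c *: h](subrK ((c * h`_m) *: 'X^m)); apply: dvdrD => //.
  apply: IHm.
    apply/leq_sizeP => j le_mj; rewrite coefB !coefZ coefXn.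
    have [->|j_neq] := eqVneq j m; first by rewrite mulr1 subrr.
    rewrite mulr0 subr0 nth_default ?mulr0 // (leq_trans h_size) //.
    by rewrite ltn_neqAle eq_sym j_neq.
  rewrite mulrBr -scalerAr -[_ *: (f * h)]mul_polyC.
  by apply: dvdrB; apply: dvdr_mull.
have r_fkh d : forall i, (size f <= i + d)%N -> dvdr r%:P (f`_i *: h).
  elim: d => [|d IHd] i le_i.
    by rewrite nth_default ?scale0r; [apply: dvdr0|rewrite -[i]addn0].
  apply: from_top; have := coef_div _ (i + m)%N r_fh.
  have lt_i : (i < (i + m).+1)%N by rewrite ltnS leq_addr.
  rewrite coefM (bigD1 (Ordinal lt_i)) //= addKn => r_sum.
  rewrite -[f`_i * h`_m](addrK (\sum_(j < (i + m).+1 | j != Ordinal lt_i)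
    f`_j * h`_(i + m - j))); apply: dvdrB => //.
  apply: dvdr_sum => j; rewrite -val_eqE /= neq_ltn => /orP [lt_ji|lt_ij].
    by rewrite [h`__]nth_default ?mulr0; [apply: dvdr0|apply: leq_trans h_size _; lia].
  by rewrite -coefZ; apply: coef_div; apply: IHd; lia.
rewrite -[h]scale1r; apply: from_top; rewrite mul1r.
apply: prim_f => i; rewrite mulrC -coefZ; apply: coef_div.
by apply: (r_fkh (size f)); rewrite leq_addl.
Qed.

Definition has_gcds (R : comNzRingType) : Prop :=
  forall a b : R, exists d,
    [/\ dvdr d a, dvdr d b & forall e, dvdr e a -> dvdr e b -> dvdr e d].

Section Gcd.
Variables (R : idomainType) (gcdR : has_gcds R).

Lemma is_gcd_exists m (a : 'I_m -> R) : exists d, is_gcd a d.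
Proof.
elim: m a => [|m IHm] a.
  by exists 0; split=> [[]//|e _]; apply: dvdr0.
have [d [d_a d_max]] := IHm (fun i => a (lift ord0 i)).
have [e [e_a e_d e_max]] := gcdR (a ord0) d.
exists e; split=> [i|c c_a].
  by case: (unliftP ord0 i) => [j ->|-> //]; apply: dvdr_trans e_d (d_a j).
by apply: e_max => //; apply: d_max => i; apply: c_a.
Qed.

(** A gcd of the [p * g i] has the form [p * t], and then [t * d] divides the
    gcd [d] of the [a i], so that [t] is a unit. *)
Lemma is_gcd_primitive m (a g : 'I_m -> R) d :
  is_gcd a d -> d != 0 -> (forall i, a i = g i * d) -> primitive g.
Proof.
move=> [d_a d_max] d_neq0 agd q p q_pg.
have [e [e_pg e_max]] := is_gcd_exists (fun i => p * g i).
have [t et] : dvdr p e by apply: e_max => i; apply/dvdr_mulr/dvdr_refl.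
have [->|p_neq0] := eqVneq p 0; first exact: dvdr0.
have [s ds] : dvdr (t * d) d.
  apply: d_max => i; rewrite agd; have [s pgs] := e_pg i.
  exists s; rewrite mulrA; congr (_ * d); apply: (mulfI p_neq0).
  by rewrite pgs et; ring.
have st : s * t = 1 by apply: (mulIf d_neq0); rewrite mul1r -mulrA.
have -> : p = s * e by rewrite et mulrA st mul1r.
by apply: dvdr_mull; apply: e_max.
Qed.

Lemma poly_content (f : {poly R}) : f != 0 ->
  exists c f1, [/\ c != 0, f = c *: f1 & primitive (fun i : nat => f1`_i)].
Proof.
move=> f_neq0; have [c c_gcd] := is_gcd_exists (fun i : 'I_(size f) => f`_i).
have [g fg] := fin_all_exists (proj1 c_gcd).
have c_neq0 : c != 0.
  apply: contraNneq f_neq0 => c0; apply/eqP/polyP => i; rewrite coef0.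
  have [lt_i|/leq_sizeP -> //] := ltnP i (size f).
  by rewrite (fg (Ordinal lt_i)) c0 mulr0.
exists c, (\poly_(i < size f) oapp g 0 (insub i)); split=> //.
  apply/polyP => i; rewrite coefZ coef_poly.
  case: insubP => [j _ <-|ge_i] /=; first by rewrite ltn_ord fg mulrC.
  by rewrite if_same mulr0 nth_default // leqNgt.
move=> q p q_p; apply: (is_gcd_primitive c_gcd c_neq0 fg) => i.
by have := q_p i; rewrite coef_poly ltn_ord valK.
Qed.

(** The element [c *: d] of least degree in the ideal [(f, g)], with [d]
    primitive, pseudo-divides [f] and [g]; the constants introduced by the
    pseudo-division are removed by Gauss's lemma.  Conversely a common divisor
    [e] of [f] and [g] is primitive and divides [c *: d]. *)
Lemma primitive_poly_gcd (f g : {poly R}) : f != 0 ->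
  primitive (fun i : nat => f`_i) -> primitive (fun i : nat => g`_i) ->
  exists d : {poly R}, [/\ primitive (fun i : nat => d`_i), dvdr d f, dvdr d g &
    forall e, dvdr e f -> dvdr e g -> dvdr e d].
Proof.
move=> f_neq0 prim_f prim_g.
pose P (d : {poly R}) := gen_ideal [:: f; g] d /\ d != 0.
have [|d0 [fgd0 d0_neq0] d0_min] := ex_minimal (fun q : {poly R} => size q) (P := P).
  by exists f; split=> //; apply: gen_ideal_mem; rewrite mem_head.
have [c [d [c_neq0 d0E prim_d]]] := poly_content d0_neq0.
have d_dvd p : p \in [:: f; g] -> dvdr d p.
  move=> /gen_ideal_mem fgp.
  have divE := Pdiv.Idomain.divp_eq p d0.
  set l := lead_coef d0 ^+ _ in divE.
  have l_neq0 : l != 0 by rewrite expf_neq0 // lead_coef_eq0.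
  have rem0 : p %% d0 = 0.
    apply/eqP; apply: contraT => rem_neq0.
    have: (size d0 <= size (p %% d0)%R)%N.
      apply: d0_min; split=> //.
      have -> : p %% d0 = (- (p %/ d0)) * d0 + l%:P * p.
        by rewrite mul_polyC divE; ring.
      apply: (proj2 (gen_ideal_is_ideal _)) => //.
      by apply: idealM => //; apply: gen_ideal_is_ideal.
    by rewrite leqNgt ltn_modp d0_neq0.
  have [q qE] : dvdr l%:P (c *: (p %/ d0)).
    apply: (primitive_poly_dvdr prim_d); exists p.
    by rewrite mulrC [RHS]mulrC mul_polyC divE rem0 addr0 -scalerAl scalerAr -d0E.
  exists q; apply: (@mulfI _ l%:P); first by rewrite polyC_eq0.
  by rewrite mul_polyC divE rem0 addr0 {2}d0E -scalerAr scalerAl qE; ring.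
exists d; split=> //; try by apply: d_dvd; rewrite !inE eqxx ?orbT.
move=> e e_f e_g; have [q qE] : dvdr e (c *: d).
  rewrite -d0E; move: fgd0 => /gen_ideal2 [a [b ->]].
  by apply: dvdrD; apply: dvdr_mull.
have prim_e : primitive (fun i : nat => e`_i).
  move=> u p u_pe; apply: prim_f => i; case: e_f => w ->.
  rewrite coefM mulr_sumr; apply: dvdr_sum => j _.
  by rewrite mulrCA; apply: dvdr_mull.
have [|q' q'E] := primitive_poly_dvdr (r := c) (h := q) prim_e.
  by exists d; rewrite mulrC -qE mulrC mul_polyC.
exists q'; apply: (@mulfI _ c%:P); first by rewrite polyC_eq0.
by rewrite mul_polyC qE q'E; ring.
Qed.

Theorem has_gcds_poly : has_gcds {poly R}.
Proof.
move=> f g.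
have [->|f_neq0] := eqVneq f 0.
  by exists g; split=> //; [apply: dvdr0|apply: dvdr_refl].
have [->|g_neq0] := eqVneq g 0.
  by exists f; split=> //; [apply: dvdr_refl|apply: dvdr0].
have [a [f1 [a_neq0 fE prim_f]]] := poly_content f_neq0.
have [b [g1 [b_neq0 gE prim_g]]] := poly_content g_neq0.
have f1_neq0 : f1 != 0 by apply: contraNneq f_neq0 => f10; rewrite fE f10 scaler0.
have [d [prim_d [p pE] [q qE] d_max]] := primitive_poly_gcd f1_neq0 prim_f prim_g.
have [c [[s sE] [t tE] c_max]] := gcdR a b.
exists (c *: d); split.
- by exists (s *: p); rewrite fE pE sE -!mul_polyC polyCM; ring.
- by exists (t *: q); rewrite gE qE tE -!mul_polyC polyCM; ring.
move=> e e_f e_g.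
have e_neq0 : e != 0 by apply: contraNneq f_neq0 => e0; case: e_f => w ->; rewrite e0 mulr0.
have [u [e1 [u_neq0 eE prim_e]]] := poly_content e_neq0.
have split_dvd (h h1 : {poly R}) (w : R) : h = w *: h1 -> dvdr e h ->
    primitive (fun i : nat => h1`_i) -> w != 0 -> dvdr u w /\ dvdr e1 h1.
  move=> -> [v vE] prim_h w_neq0; split.
    apply: prim_h => i; rewrite -coefZ vE eE -scalerAr coefZ.
    exact/dvdr_mulr/dvdr_refl.
  have [|v' v'E] := primitive_poly_dvdr (r := w) (h := u *: v) prim_e.
    by exists h1; rewrite [RHS]mulrC mul_polyC vE eE -!mul_polyC; ring.
  exists v'; apply: (@mulfI _ w%:P); first by rewrite polyC_eq0.
  by rewrite mul_polyC vE eE -scalerAr scalerAl v'E; ring.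
have [u_a e1_f1] := split_dvd _ _ _ fE e_f prim_f a_neq0.
have [u_b e1_g1] := split_dvd _ _ _ gE e_g prim_g b_neq0.
have [x xE] := c_max u u_a u_b; have [y yE] := d_max e1 e1_f1 e1_g1.
by exists (x *: y); rewrite xE yE eE -!mul_polyC polyCM; ring.
Qed.

End Gcd.

Lemma has_gcds_field (k : fieldType) : has_gcds k.
Proof.
move=> a b; have [->|a_neq0] := eqVneq a 0.
  by exists b; split=> //; [apply: dvdr0|apply: dvdr_refl].
exists a; split=> //; first exact: dvdr_refl.
by exists (b / a); rewrite divfK.
Qed.

Lemma has_gcds_bij (S T : comNzRingType) (f : {rmorphism S -> T}) :
  bijective f -> has_gcds S -> has_gcds T.
Proof.
case=> f' fK f'K gcdS a b.
have f_dvd x y : dvdr x y -> dvdr (f x) (f y).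
  by case=> q ->; exists (f q); rewrite rmorphM.
have f'_dvd x y : dvdr x y -> dvdr (f' x) (f' y).
  by case=> q ->; exists (f' q); apply: (can_inj fK); rewrite rmorphM !f'K.
have [d [d_a d_b d_max]] := gcdS (f' a) (f' b); exists (f d); split.
- by rewrite -[a]f'K; apply: f_dvd.
- by rewrite -[b]f'K; apply: f_dvd.
by move=> e /f'_dvd e_a /f'_dvd e_b; rewrite -[e]f'K; apply: f_dvd; apply: d_max.
Qed.

(** * Polynomial rings over a field *)

Section MPolyLastVariable.
Variables (R : comNzRingType) (n : nat).

(** The isomorphism [R[x_0, ..., x_(n-1)][X] -> R[x_0, ..., x_n], with [X] sent
    to the last variable. *)
Definition join_last : {poly {mpoly R[n]}} -> {mpoly R[n.+1]} :=
  horner_morph (fun p : {mpoly R[n]} => mulrC 'X_ord_max (mwiden p)).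

HB.instance Definition _ := GRing.RMorphism.on join_last.

Lemma join_lastC p : join_last p%:P = mwiden p.
Proof. exact: horner_morphC. Qed.

Lemma join_lastX : join_last 'X = 'X_ord_max.
Proof. exact: horner_morphX. Qed.

Lemma muni_monomial m : muni ('X_[m] : {mpoly R[n.+1]}) =
  'X_[[multinom m (widen_ord (leqnSn n) i) | i < n]] *: 'X^(m ord_max).
Proof. by rewrite muniE msuppX big_seq1 mcoeffX eqxx scale1r. Qed.

Lemma join_lastK : cancel join_last (@muni n R).
Proof.
elim/poly_ind=> [|p c IHp]; first by rewrite !rmorph0.
rewrite !rmorphD !rmorphM /= IHp join_lastX join_lastC; congr (_ * _ + _).
  rewrite muni_monomial mnm1E eqxx expr1 (_ : [multinom _ | i < n] = 0%MM).
    by rewrite mpolyX0 scale1r.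
  apply/mnmP => i; rewrite mnmE mnm1E mnm0E -val_eqE /=.
  by rewrite gtn_eqF.
elim/mpolyind: c => [|a m c _ _ IHc]; first by rewrite mwiden0 rmorph0.
rewrite mwidenD rmorphD /= IHc polyCD; congr (_ + _).
rewrite mwidenZ muniZ mwidenX muni_monomial mnmwiden_ordmax expr0 alg_polyC.
rewrite (_ : [multinom _ | i < n] = m).
  by rewrite -mul_mpolyC polyCM mul_polyC.
by apply/mnmP => i; rewrite mnmE mnmwiden_widen.
Qed.

Lemma muniK : cancel (@muni n R) join_last.
Proof.
elim/mpolyind=> [|a m p _ _ IHp]; first by rewrite !rmorph0.
rewrite muniD rmorphD /= [X in _ + X]IHp; apply: (congr1 (fun q => q + p)).
rewrite muniZ muni_monomial -!mul_polyC !rmorphM /= !join_lastC rmorphXn /=.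
rewrite join_lastX mwidenC mwidenX -mul_mpolyC mpolyXn -mpolyXD.
congr (_ * 'X_[_]); apply/mnmP => i; rewrite mnmDE mulmnE mnm1E.
case: (unliftP ord_max i) => [j ->|->].
  have -> : lift ord_max j = widen_ord (leqnSn n) j.
    by apply: val_inj; rewrite /= /bump leqNgt ltn_ord.
  by rewrite mnmwiden_widen mnmE -val_eqE /= gtn_eqF // addn0.
by rewrite mnmwiden_ordmax eqxx add0n mul1n.
Qed.

End MPolyLastVariable.

Lemma mpolyC_bij (R : comNzRingType) : bijective (@mpolyC 0 R).
Proof.
exists (fun p => p@_0) => [c|p]; first by rewrite mcoeffC eqxx mulr1.
apply/mpolyP => m; rewrite mcoeffC (_ : m = 0%MM) ?eqxx ?mulr1 //.
by apply/mnmP => -[].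
Qed.

Lemma mpoly_noetherian (k : fieldType) n : noetherian {mpoly k[n]}.
Proof.
elim: n => [|n IHn].
  apply: (noetherian_surj (f := @mpolyC 0 k)); last exact: noetherian_field.
  by case: (mpolyC_bij k) => f _ fK p; exists (f p); apply: fK.
apply: (noetherian_surj (f := @join_last k n)); last exact: hilbert_basis.
by move=> p; exists (muni p); apply: muniK.
Qed.

Lemma mpoly_has_gcds (k : fieldType) n : has_gcds {mpoly k[n]}.
Proof.
elim: n => [|n IHn].
  exact: (has_gcds_bij (f := @mpolyC 0 k)) (mpolyC_bij k) (@has_gcds_field k).
apply: (has_gcds_bij (f := @join_last k n)); last exact: has_gcds_poly.
exact: Bijective (@join_lastK k n) (@muniK k n).
Qed.

(** * Matrices of corank one over a domain *)

Lemma rank_minor_neq0 (F : fieldType) m (A : 'M[F]_(m.+1, m)) :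
  \rank A = m -> exists i, \det (row' i A) != 0.
Proof.
move=> rkA; have [y [y_neq0 yA]] : exists y : 'rV_m.+1, y != 0 /\ y *m A = 0.
  have ker_neq0 : kermx A != 0 by rewrite -mxrank_eq0 mxrank_ker rkA subSnn.
  have /rowV0Pn [y /sub_kermxP yA y_neq0] := ker_neq0.
  by exists y.
have [i yi_neq0] : exists i, y 0 i != 0.
  apply/existsP; apply: contraNT y_neq0 => /existsPn y0.
  by apply/eqP/rowP => i; rewrite mxE; apply/eqP; have := y0 i; rewrite negbK.
exists i; have sub_row' l : l != i -> (row l A <= row' i A)%MS.
  rewrite eq_sym => /unlift_some [l' -> _].
  rewrite (_ : row _ A = row l' (row' i A)) ?row_sub //.
  by apply/rowP => c; rewrite !mxE.
have subA : (A <= row' i A)%MS.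
  apply/row_subP => l; have [->|/sub_row' //] := eqVneq l i.
  have -> : row i A = - (y 0 i)^-1 *: \sum_(l | l != i) y 0 l *: row l A.
    have := mulmx_sum_row y A; rewrite yA (bigD1 i) //= => /esym/eqP.
    rewrite addrC addr_eq0 => /eqP ->.
    by rewrite scaleNr scalerN opprK scalerA mulVf // scale1r.
  by apply/scalemx_sub/summx_sub => c ne_ci; apply/scalemx_sub/sub_row'.
rewrite -unitfE -unitmxE -row_full_unit /row_full eqn_leq rank_leq_row /=.
by rewrite -[X in (X <= _)%N]rkA mxrankS.
Qed.

Section CorankOne.
Variables (R : idomainType) (m : nat).
Implicit Types (M : 'M[R]_m.+1) (g h v w : 'rV[R]_m.+1).

Lemma frac_rank_trmx M : frac_rank M^T = frac_rank M.
Proof.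
rewrite /frac_rank -[RHS]mxrank_tr; congr (\rank _).
by apply/matrixP => i j; rewrite !mxE.
Qed.

Lemma frac_rank_det0 M : frac_rank M = m -> \det M = 0.
Proof.
move=> rkM; apply/eqP; rewrite -tofrac_eq0 -det_map_mx; apply: contraT.
rewrite -unitfE -unitmxE -row_full_unit /row_full => /eqP full.
by move: rkM; rewrite /frac_rank full => /eqP; rewrite eqn_leq ltnn.
Qed.

Lemma frac_rank_minor_neq0 (N : 'M[R]_(m.+1, m)) :
  frac_rank N = m -> exists i, \det (row' i N) != 0.
Proof.
move=> /rank_minor_neq0 [i]; rewrite -map_row' det_map_mx tofrac_eq0 => det_i.
by exists i.
Qed.

Lemma left_kernel_proportional M v w : frac_rank M = m ->
  v *m M = 0 -> w *m M = 0 -> forall i j, v 0 i * w 0 j = v 0 j * w 0 i.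
Proof.
move=> rkM vM wM i j; have [->|w_neq0] := eqVneq w 0.
  by rewrite !mxE !mulr0.
pose F := map_mx (@FracField.tofrac R).
have ker_sub (u : 'rV[R]_m.+1) : u *m M = 0 -> (F _ _ u <= kermx (F _ _ M))%MS.
  by move=> uM; apply/sub_kermxP; rewrite -map_mxM uM map_mx0.
have Fw_neq0 : F _ _ w != 0.
  apply: contraNneq w_neq0 => Fw0; apply/eqP/rowP => l.
  move/rowP: Fw0 => /(_ l); rewrite !mxE => /eqP.
  by rewrite tofrac_eq0 => /eqP.
have rk_ker : \rank (kermx (F _ _ M)) = 1%N.
  by rewrite mxrank_ker [X in (_ - X)%N]rkM subSnn.
have w_full : (kermx (F _ _ M) <= F _ _ w)%MS.
  have [_ <-] := mxrank_leqif_sup (ker_sub w wM).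
  by rewrite rk_ker rank_rV Fw_neq0.
have /sub_rVP [c vE] := submx_trans (ker_sub v vM) w_full.
have comp l : FracField.tofrac (v 0 l) = c * FracField.tofrac (w 0 l).
  by move/rowP: vE => /(_ l); rewrite !mxE.
by apply/eqP; rewrite -tofrac_eq !tofracM !comp; apply/eqP; ring.
Qed.

Lemma primitive_neq0 n (g : 'rV[R]_n) : primitive (fun i => g 0 i) ->
  exists i, g 0 i != 0.
Proof.
move=> prim_g; apply/existsP; apply: contraT => /existsPn g0.
have [|q /eqP] := prim_g 0 1; last by rewrite mulr0 oner_eq0.
by move=> i; have := g0 i; rewrite negbK => /eqP ->; rewrite mulr0; apply: dvdr0.
Qed.

Lemma primitive_left_kernel M v g : frac_rank M = m ->
  primitive (fun i => g 0 i) -> g *m M = 0 -> v *m M = 0 -> exists b, v = b *: g.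
Proof.
move=> rkM prim_g gM vM; have [j gj_neq0] := primitive_neq0 prim_g.
have prop i : v 0 j * g 0 i = v 0 i * g 0 j.
  exact: left_kernel_proportional rkM vM gM j i.
have [|b bE] := prim_g (g 0 j) (v 0 j).
  by move=> i; rewrite prop; apply/dvdr_mull/dvdr_refl.
exists b; apply/rowP => i; apply: (mulIf gj_neq0).
by rewrite mxE -prop bE; ring.
Qed.

(** Up to sign, the signed minors used for [gamma M] form a column of the
    cofactor matrix, and [\adj M *m M = 0]. *)
Lemma is_gamma_kernel M g : has_gcds R -> frac_rank M = m -> is_gamma M g ->
  primitive (fun i => g 0 i) /\ g *m M = 0.
Proof.
move=> gcdR rkM [j [d [rkN d_gcd gdE]]].
have d_neq0 : d != 0.
  have [i det_i] := frac_rank_minor_neq0 rkN.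
  apply: contraNneq det_i => d0.
  by rewrite -[\det _](signrMK i) [_ * \det _]gdE d0 !mulr0.
split; first exact: (is_gcd_primitive gcdR d_gcd d_neq0 gdE).
apply/rowP => l; apply: (mulfI d_neq0); apply: (can_inj (signrMK j)).
have /matrixP/(_ j l) := mul_adj_mx M; rewrite frac_rank_det0 // !mxE mul0rn => adj0.
rewrite !mulr0 -[RHS]adj0 !mulr_sumr; apply: eq_bigr => i _.
rewrite mxE /cofactor exprD mulrA [d * _]mulrC -gdE /signed_minor.
by ring.
Qed.

(** Each row of the cofactor matrix lies in the right kernel of [M], hence is a
    multiple of [h]; the factors form a vector in the left kernel of [M],
    hence a multiple of [g]. *)
Lemma cofactor_rank_one M g h : frac_rank M = m ->
  primitive (fun i => g 0 i) -> primitive (fun i => h 0 i) ->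
  g *m M = 0 -> h *m M^T = 0 ->
  exists a, forall i j, cofactor M i j = a * (g 0 i * h 0 j).
Proof.
move=> rkM prim_g prim_h gM hM; have detM := frac_rank_det0 rkM.
have [j hj_neq0] := primitive_neq0 prim_h.
have row_h i : exists b, \row_l cofactor M i l = b *: h.
  apply: (primitive_left_kernel (M := M^T)) => //; first by rewrite frac_rank_trmx.
  apply/rowP => l; have /matrixP/(_ l i) := mul_mx_adj M.
  rewrite detM !mxE mul0rn => adj0; rewrite -[RHS]adj0.
  by apply: eq_bigr => c _; rewrite !mxE mulrC.
have [b bE] := fin_all_exists row_h.
have cofE i l : cofactor M i l = b i * h 0 l.
  by have /rowP/(_ l) := bE i; rewrite !mxE.
have [|a aE] := primitive_left_kernel (v := \row_i b i) rkM prim_g gM.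
  apply/rowP => l; apply: (mulIf hj_neq0).
  have /matrixP/(_ j l) := mul_adj_mx M; rewrite detM !mxE mul0rn => adj0.
  rewrite mul0r -[RHS]adj0 mulr_suml; apply: eq_bigr => i _.
  by rewrite !mxE cofE mulrAC.
exists a => i l; rewrite cofE mulrA.
by have /rowP/(_ i) := aE; rewrite !mxE => ->.
Qed.

End CorankOne.

Lemma scalemx_inj (R : idomainType) p q (a : R) :
  a != 0 -> injective (fun A : 'M[R]_(p, q) => a *: A).
Proof.
move=> a_neq0 A B /matrixP eqAB; apply/matrixP => i j; apply: (mulfI a_neq0).
by have := eqAB i j; rewrite !mxE.
Qed.

(** Adjugates of nonsingular matrices are determined by [\adj A *m A = \det A];
    the general case follows by perturbing [A] to ['X + A], whose determinant
    is a monic polynomial. *)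
Lemma adj_mulmx (R : idomainType) n (A B : 'M[R]_n) :
  \adj (A *m B) = \adj B *m \adj A.
Proof.
have nonsingular (S : idomainType) (C D : 'M[S]_n) :
    \det C != 0 -> \det D != 0 -> \adj (C *m D) = \adj D *m \adj C.
  move=> detC detD; have detCD : \det (C *m D) != 0 by rewrite det_mulmx mulf_neq0.
  have := mul_adj_mx (C *m D); rewrite det_mulmx mulrC => adjCD.
  have adjDC : (\adj D *m \adj C) *m (C *m D) = (\det D * \det C)%:M.
    rewrite mulmxA -[_ *m _ *m C]mulmxA mul_adj_mx mul_mx_scalar -scalemxAl.
    by rewrite mul_adj_mx scale_scalar_mx mulrC.
  apply: (scalemx_inj detCD); rewrite /= -!mul_mx_scalar -(mul_mx_adj (C *m D)).
  by rewrite !(mulmxA _ (C *m D)) adjCD adjDC.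
have eval0 (C : 'M[R]_n) : map_mx (horner_eval 0) (char_poly_mx (- C)) = C.
  apply/matrixP => i j; rewrite !mxE /horner_eval !(hornerE, hornerMn).
  by rewrite mul0rn sub0r opprK.
have det_neq0 (C : 'M[R]_n) : \det (char_poly_mx (- C)) != 0.
  exact: monic_neq0 (char_poly_monic _).
rewrite -[A in LHS]eval0 -[B in LHS]eval0 -map_mxM -map_mx_adj.
by rewrite nonsingular // map_mxM !map_mx_adj !eval0.
Qed.

(** * Exactness and the cofactor matrix *)

Section ExactComplex.
Variables (R : idomainType) (m : nat) (M : 'M[R]_m.+1) (g h : 'rV[R]_m.+1).
Hypothesis rkM : frac_rank M = m.
Hypothesis prim_g : primitive (fun i => g 0 i).
Hypothesis prim_h : primitive (fun i => h 0 i).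
Hypothesis gM : g *m M = 0.
Hypothesis hM : h *m M^T = 0.

Lemma mulmx_kernel : M *m h^T = 0.
Proof. by rewrite -[M]trmxK -trmx_mul hM trmx0. Qed.

Lemma kernel_generated (w : 'cV[R]_m.+1) : M *m w = 0 -> exists b, w = b *: h^T.
Proof.
move=> Mw; have [||b bE] := primitive_left_kernel (M := M^T) (v := w^T) _ prim_h hM.
- by rewrite frac_rank_trmx.
- by rewrite -trmx_mul Mw trmx0.
by exists b; rewrite -[w]trmxK bE linearZ.
Qed.

Section Sufficiency.
Variable u : R.
Hypothesis u_unit : u \is a GRing.unit.
Hypothesis cofM : forall i j, cofactor M i j = u * (g 0 i * h 0 j).

Lemma minor_cofactor i j :
  \det (row' i (col' j M)) = (-1) ^+ (i + j) * (u * (g 0 i * h 0 j)).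
Proof. by rewrite -cofM /cofactor signrMK. Qed.

(** Cramer's rule for the system without its [i]-th equation, which is
    implied by the others as [g 0 i != 0], solves [N *m x = g 0 i *: (h 0 j *: v)]
    for [N] the matrix [M] without column [j].  The solution for [h 0 j *: v] over
    the field of fractions is unique, so each of the [g 0 i] clears its
    denominators; as [g] is primitive, it is integral. *)
Lemma kernel_scaled_in_image (v : 'cV[R]_m.+1) j :
  g *m v = 0 -> exists w, h 0 j *: v = M *m w.
Proof.
move=> gv; have [hj0|hj_neq0] := eqVneq (h 0 j) 0.
  by exists 0; rewrite hj0 scale0r mulmx0.
pose N := col' j M; pose P : 'M[R]_(m.+1, m) := col' j 1%:M.
have NE : N = M *m P by rewrite /P col'Esub mulmx_colsub mulmx1.
have gN : g *m N = 0 by rewrite NE mulmxA gM mul0mx.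
have row'M i p (x : 'M[R]_(m, p)) : row' i (N *m x) = row' i N *m x.
  by rewrite !row'Esub mul_rowsub_mx.
have cramer i : exists y : 'cV[R]_m, N *m y = g 0 i *: (h 0 j *: v).
  have [gi0|gi_neq0] := eqVneq (g 0 i) 0.
    by exists 0; rewrite gi0 scale0r mulmx0.
  pose x := \adj (row' i N) *m row' i v.
  pose e := N *m x - \det (row' i N) *: v.
  have row'e : row' i e = 0.
    rewrite /e linearB linearZ /= row'M /x mulmxA mul_mx_adj mul_scalar_mx.
    by rewrite subrr.
  have ge : g *m e = 0.
    by rewrite mulmxBr mulmxA gN mul0mx -scalemxAr gv scaler0 subrr.
  have e_off l : l != i -> e l 0 = 0.
    rewrite eq_sym => /unlift_some [l' -> _].
    by have /matrixP/(_ l' 0) := row'e; rewrite !mxE.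
  have e0 : e = 0.
    apply/colP => l; rewrite [RHS]mxE; have [->|/e_off //] := eqVneq l i.
    have /matrixP/(_ 0 0) := ge.
    rewrite mxE [RHS]mxE (bigD1 i) //= big1 ?addr0.
      by move/eqP; rewrite mulf_eq0 (negbTE gi_neq0) => /eqP.
    by move=> l' /e_off ->; rewrite mulr0.
  exists ((u^-1 * (-1) ^+ (i + j)) *: x); rewrite -scalemxAr.
  move/eqP: e0; rewrite subr_eq0 => /eqP ->; rewrite minor_cofactor !scalerA.
  congr (_ *: v); by rewrite -mulrA signrMK mulKr.
have [y yE] := fin_all_exists cramer.
have [i gi_neq0] := primitive_neq0 prim_g.
have N_inj (x : 'cV[R]_m) : N *m x = 0 -> x = 0.
  move=> Nx; have det_neq0 : \det (row' i N) != 0.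
    rewrite minor_cofactor mulf_neq0 ?signr_eq0 // mulf_neq0 ?mulf_neq0 //.
    by apply: contraTneq u_unit => ->; rewrite unitr0.
  apply: (scalemx_inj det_neq0); rewrite /= -mul_scalar_mx -mul_adj_mx.
  by rewrite -mulmxA -row'M Nx linear0 mulmx0 scaler0.
have yi l : g 0 l *: y i = g 0 i *: y l.
  apply/eqP; rewrite -subr_eq0; apply/eqP/N_inj.
  rewrite mulmxBr -!scalemxAr !yE [g 0 l *: (g 0 i *: _)]scalerA.
  by rewrite [g 0 l * _]mulrC -scalerA subrr.
have /fin_all_exists [z zE] : forall c, dvdr (g 0 i) (y i c 0).
  move=> c; apply: prim_g => l; exists (y l c 0).
  by have /colP/(_ c) := yi l; rewrite !mxE => yiE; rewrite mulrC yiE mulrC.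
exists (P *m \col_c z c); rewrite mulmxA -NE.
apply: (scalemx_inj gi_neq0); rewrite /= -yE scalemxAr.
by congr (N *m _); apply/colP => c; rewrite !mxE zE mulrC.
Qed.

(** A descent along a regular sequence, where a general argument would use the
    vanishing of Koszul cohomology.  The solutions [w1], [w2], [w3] fit together
    up to multiples [b12], [b13], [b23] of [h]; these satisfy a cocycle relation,
    which gives a correction after which [a1 *: w2 = a2 *: w1].  Then [w1] is
    divisible by [a1]. *)
Lemma image_descent (a1 a2 a3 : R) (v : 'cV[R]_m.+1) : a1 != 0 ->
  (forall x, dvdr a1 (a2 * x) -> dvdr a1 x) ->
  (forall x, gen_ideal [:: a1; a2] (a3 * x) -> gen_ideal [:: a1; a2] x) ->
  (exists w, a1 *: v = M *m w) -> (exists w, a2 *: v = M *m w) ->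
  (exists w, a3 *: v = M *m w) -> exists w, v = M *m w.
Proof.
move=> a1_neq0 reg2 reg3 [w1 w1E] [w2 w2E] [w3 w3E].
have glue (a b : R) (w w' : 'cV[R]_m.+1) : a *: v = M *m w -> b *: v = M *m w' ->
    exists c, a *: w' - b *: w = c *: h^T.
  move=> aE bE; apply: kernel_generated.
  by rewrite mulmxBr -!scalemxAr -aE -bE !scalerA mulrC subrr.
have [b12 b12E] := glue _ _ _ _ w1E w2E.
have [b13 b13E] := glue _ _ _ _ w1E w3E.
have [b23 b23E] := glue _ _ _ _ w2E w3E.
have [j hj_neq0] := primitive_neq0 prim_h.
have cocycle : a3 * b12 = (- b23) * a1 + b13 * a2.
  apply: (mulIf hj_neq0).
  move/colP/(_ j): b12E; move/colP/(_ j): b13E; move/colP/(_ j): b23E.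
  rewrite !mxE => e23 e13 e12.
  transitivity (a2 * (b13 * h 0 j) - a1 * (b23 * h 0 j)); last by ring.
  by rewrite -mulrA -e12 -e13 -e23; ring.
have [c1 [c2 b12_split]] : exists c1 c2, b12 = c1 * a1 + c2 * a2.
  by apply/gen_ideal2; apply: reg3; apply/gen_ideal2; exists (- b23), b13.
pose w1' := w1 + c2 *: h^T; pose w2' := w2 - c1 *: h^T.
have w12' : a1 *: w2' = a2 *: w1'.
  apply/eqP; rewrite -subr_eq0; apply/eqP.
  transitivity (b12 *: h^T - (c1 * a1 + c2 * a2) *: h^T).
    by rewrite -b12E; apply/colP => l; rewrite !mxE; ring.
  by rewrite b12_split subrr.
have /fin_all_exists [w wE] : forall l, dvdr a1 (w1' l 0).
  move=> l; apply: reg2; exists (w2' l 0).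
  by move/colP/(_ l): w12'; rewrite mxE [RHS]mxE => <-; rewrite mulrC.
exists (\col_l w l); apply: (scalemx_inj a1_neq0); rewrite /= w1E scalemxAr.
rewrite (_ : a1 *: _ = w1'); last first.
  by apply/colP => l; rewrite [RHS]wE !mxE; apply: mulrC.
by rewrite /w1' mulmxDr -scalemxAr mulmx_kernel scaler0 addr0.
Qed.

End Sufficiency.

Section Necessity.
Hypothesis exactM : forall v : 'cV[R]_m.+1, g *m v = 0 -> exists w, v = M *m w.

(** For each [i] the columns of [g 0 i *: 1 - e_i *m g] are killed by [g], so this
    matrix factors through [M].  Its [(i, i)] cofactor [g 0 i ^+ m] is then a
    combination of cofactors of [M], so that [a] divides every [g 0 i ^+ m]. *)
Lemma cofactor_factor_unit a :
  (forall i j, cofactor M i j = a * (g 0 i * h 0 j)) -> a \is a GRing.unit.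
Proof.
move=> cofM; suff [q /esym qa] : dvdr a 1 by apply/unitrPr; exists q; rewrite mulrC.
apply: (primitive_pow (e := fun=> m) prim_g) => i; rewrite mul1r.
pose V : 'M[R]_m.+1 := (g 0 i)%:M - delta_mx i 0 *m g.
have gV : g *m V = 0.
  rewrite mulmxBr mul_mx_scalar mulmxA; apply/eqP; rewrite subr_eq0.
  apply/eqP/rowP => l; rewrite !mxE big_ord1 !mxE (bigD1 i) //= big1 => [|c].
    by rewrite mxE !eqxx mulr1 addr0.
  by rewrite mxE => /negbTE ->; rewrite mulr0.
have /fin_all_exists [w wE] l : exists w, col l V = M *m w.
  by apply: exactM; rewrite colE mulmxA gV mul0mx.
have VE : V = M *m \matrix_(c, l) w l c 0.
  apply/matrixP => c l; have /colP/(_ c) := wE l; rewrite mxE => ->.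
  by rewrite !mxE; apply: eq_bigr => c' _; rewrite !mxE.
have <- : (\adj V) i i = g 0 i ^+ m.
  rewrite mxE /cofactor (_ : row' i (col' i V) = (g 0 i)%:M) ?det_scalar.
    by rewrite exprD -expr2 sqrr_sign mul1r.
  apply/matrixP => c l; rewrite !mxE big_ord1 !mxE.
  by rewrite (inj_eq (@lift_inj _ i)) [_ == i]eq_sym (negbTE (neq_lift i c)) mul0r subr0.
rewrite VE adj_mulmx mxE; apply: dvdr_sum => l _; apply: dvdr_mull.
by rewrite mxE cofM; apply/dvdr_mulr/dvdr_refl.
Qed.

(** If [s *: h^T = a1 *: x + a2 *: y], then regularity gives [z] with
    [M *m y = a1 *: z] and [M *m x = - a2 *: z], and exactness writes [z] as
    [M *m t].  Subtracting multiples of [t] puts [x] and [y] into the kernel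
    spanned by [h], and cancelling [h] shows that [s] is in [(a1, a2)]. *)
Lemma kernel_ideal_faithful a1 a2 s : a1 != 0 ->
  (forall x, dvdr a1 (a2 * x) -> dvdr a1 x) ->
  (forall j, gen_ideal [:: a1; a2] (s * h 0 j)) -> gen_ideal [:: a1; a2] s.
Proof.
move=> a1_neq0 reg2 sh.
have /fin_all_exists [x /fin_all_exists [y shE]] j :
    exists x y, s * h 0 j = x * a1 + y * a2.
  by apply/gen_ideal2; apply: sh.
pose X := \col_j x j; pose Y := \col_j y j.
have shXY : s *: h^T = a1 *: X + a2 *: Y.
  by apply/colP => j; rewrite !mxE shE; ring.
have MXY : a1 *: (M *m X) + a2 *: (M *m Y) = 0.
  by rewrite !scalemxAr -mulmxDr -shXY -scalemxAr mulmx_kernel scaler0.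
have /fin_all_exists [z zE] l : dvdr a1 ((M *m Y) l 0).
  apply: reg2; exists (- (M *m X) l 0).
  have aMX : a1 * (M *m X) l 0 + a2 * (M *m Y) l 0 = 0.
    by move/colP/(_ l): MXY; rewrite mxE [X in X + _]mxE [X in _ + X]mxE [RHS]mxE.
  by apply/eqP; rewrite -subr_eq0 -[X in _ == X]aMX; apply/eqP; ring.
pose Z := \col_l z l.
have MY : M *m Y = a1 *: Z.
  by apply/colP => l; rewrite zE !mxE mulrC.
have MX : M *m X = - (a2 *: Z).
  apply: (scalemx_inj a1_neq0); move/eqP: MXY; rewrite addr_eq0 /= => /eqP ->.
  by rewrite MY scalerN !scalerA mulrC.
have [t ZE] : exists t, Z = M *m t.
  apply: exactM; apply: (scalemx_inj a1_neq0).
  by rewrite /= scalemxAr -MY mulmxA gM mul0mx scaler0.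
have [|b YE] := kernel_generated (w := Y - a1 *: t).
  by rewrite mulmxBr MY ZE -scalemxAr subrr.
have [|a XE] := kernel_generated (w := X + a2 *: t).
  by rewrite mulmxDr MX ZE -scalemxAr addNr.
have [j hj_neq0] := primitive_neq0 prim_h.
apply/gen_ideal2; exists a, b; apply: (mulIf hj_neq0).
move/colP/(_ j): XE; move/colP/(_ j): YE; move/colP/(_ j): shXY.
rewrite mxE [h^T _ _]mxE => -> YE XE.
rewrite !mxE in XE YE *; rewrite mulrDl ![_ * _ * h 0 j]mulrAC -XE -YE.
by ring.
Qed.

End Necessity.
End ExactComplex.

(** * Presentation matrices *)

Section RowForm.
Variables (R : comNzRingType) (n : nat) (g : 'rV[R]_n).

Definition row_form (v : 'cV[R]_n) : R^o := (g *m v) 0 0.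

Lemma row_form_is_linear : linear row_form.
Proof. by move=> c v w; rewrite /row_form linearP !mxE. Qed.

HB.instance Definition _ :=
  GRing.isLinear.Build R 'cV[R]_n R^o _ row_form row_form_is_linear.

Lemma row_form_eq0 v : row_form v = 0 <-> g *m v = 0.
Proof.
split=> [gv|gv]; last by rewrite /row_form gv mxE.
by apply/matrixP => i j; rewrite !ord1 [RHS]mxE.
Qed.

End RowForm.

Lemma linear_form_row (R : comNzRingType) n (psi : {linear 'cV[R]_n -> R^o}) v :
  psi v = row_form (\row_i psi (delta_mx i 0)) v.
Proof.
rewrite {1}[v]matrix_sum_delta linear_sum /row_form mxE; apply: eq_bigr => i _.
by rewrite big_ord1 linearZ mxE mulrC.
Qed.

Section Presentation.
Variables (R : idomainType) (m : nat) (M : 'M[R]_m.+1) (g h : 'rV[R]_m.+1).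
Hypothesis rkM : frac_rank M = m.
Hypothesis prim_g : primitive (fun i => g 0 i).
Hypothesis prim_h : primitive (fun i => h 0 i).
Hypothesis gM : g *m M = 0.
Hypothesis hM : h *m M^T = 0.

(** A linear form vanishing on the columns of [M] is a multiple of [g], so the
    kernel of [g] is the smallest that can occur. *)
Lemma presentation_matrixP : presentation_matrix M <->
  forall v : 'cV[R]_m.+1, g *m v = 0 -> exists w, v = M *m w.
Proof.
split=> [[psi psiP]|exactM].
  pose p : 'rV[R]_m.+1 := \row_i psi (delta_mx i 0).
  have [|c pE] := primitive_left_kernel (v := p) rkM prim_g gM.
    apply/rowP => l; have /psiP : exists w, col l M = M *m w.
      by exists (delta_mx l 0); rewrite colE.
    rewrite linear_form_row -/p => /row_form_eq0; rewrite colE mulmxA -colE.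
    by move/matrixP/(_ 0 0); rewrite mxE => ->; rewrite !mxE.
  move=> v gv; apply/psiP; rewrite linear_form_row -/p pE.
  by apply/row_form_eq0; rewrite -scalemxAl gv scaler0.
exists (row_form g) => v; split; first by move/row_form_eq0/exactM.
by case=> w ->; apply/row_form_eq0; rewrite mulmxA gM mul0mx.
Qed.

Let J := gen_ideal [seq h 0 j | j <- enum 'I_m.+1].

Lemma gen_ideal_entry j : J (h 0 j).
Proof. by apply: gen_ideal_mem; apply: map_f; rewrite mem_enum. Qed.

(** A regular sequence is built in [J]: after a nonzero entry of [h], each new
    element exists because [J] annihilates nothing modulo the previous ones.
    For one element this is the primitivity of [h], for two it is
    [kernel_ideal_faithful]. *)
Lemma exact_depth_ge3 : noetherian R ->
  (forall v : 'cV[R]_m.+1, g *m v = 0 -> exists w, v = M *m w) -> depth_ge J 3.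
Proof.
move=> noethR exactM; have [J1|nJ1] := classic (J 1); [by left|right].
have idJ : is_ideal J := gen_ideal_is_ideal _.
have [j hj_neq0] := primitive_neq0 prim_h.
have [|a2 Ja2 reg2] := exists_nonzerodivisor_mod noethR
    (gen_ideal_is_ideal [:: h 0 j]) idJ.
  move=> s sJ; apply/gen_ideal1; apply: prim_h => l; apply/gen_ideal1.
  exact/sJ/gen_ideal_entry.
have reg2' x : dvdr (h 0 j) (a2 * x) -> dvdr (h 0 j) x.
  by move=> /gen_ideal1 /reg2 /gen_ideal1.
have [|a3 Ja3 reg3] := exists_nonzerodivisor_mod noethR
    (gen_ideal_is_ideal [:: h 0 j; a2]) idJ.
  move=> s sJ; apply: kernel_ideal_faithful rkM prim_h gM hM exactM _ _ _ hj_neq0 reg2' _.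
  by move=> l; apply/sJ/gen_ideal_entry.
have sub_J x : x \in [:: h 0 j; a2; a3] -> J x.
  by rewrite !inE => /or3P [] /eqP -> //; apply: gen_ideal_entry.
exists [:: h 0 j; a2; a3]; split=> //; split; last first.
  by move=> /(gen_ideal_min idJ sub_J).
case=> [|[|[|//]]] _ x /=; first 2 last.
- exact: reg3.
- by move=> /gen_ideal_nil /eqP; rewrite mulf_eq0 (negbTE hj_neq0) => /eqP ->; apply: gen_ideal0.
- exact: reg2.
Qed.

Lemma depth_ge3_exact u : u \is a GRing.unit ->
  (forall i j, cofactor M i j = u * (g 0 i * h 0 j)) -> depth_ge J 3 ->
  forall v : 'cV[R]_m.+1, g *m v = 0 -> exists w, v = M *m w.
Proof.
move=> u_unit cofM depthJ v gv.
(* The elements of the ring that multiply [v] into the image of [M]. *)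
pose K (a : R) := exists w, a *: v = M *m w.
have idK : is_ideal K.
  split=> [|c a b [w wE] [w' w'E]]; first by exists 0; rewrite scale0r mulmx0.
  exists (c *: w + w'); rewrite mulmxDr -scalemxAr -wE -w'E.
  by rewrite scalerDl scalerA.
have JK : forall a, J a -> K a.
  apply: gen_ideal_min => // _ /mapP [j _ ->].
  exact: kernel_scaled_in_image u_unit cofM _ _ gv.
case: depthJ => [/JK [w]|[s [[reg _] s_size sJ]]]; first by rewrite scale1r; exists w.
case: s s_size reg sJ => [|a1 [|a2 [|a3 s]]] //= _ reg sJ.
have Ka a : a \in [:: a1, a2, a3 & s] -> K a by move=> /sJ/JK.
apply: (image_descent rkM prim_h hM (a1 := a1) (a2 := a2) (a3 := a3)).
- apply/eqP => a10; have /gen_ideal_nil/eqP : gen_ideal [::] (1 : R).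
    by apply: (reg 0%N) => //=; rewrite a10 mul0r; apply: gen_ideal0.
  by rewrite oner_eq0.
- by move=> x a1_x; apply/gen_ideal1; apply: (reg 1%N) => //=; apply/gen_ideal1.
- by move=> x; apply: (reg 2%N).
- by apply: Ka; rewrite !inE eqxx.
- by apply: Ka; rewrite !inE eqxx orbT.
- by apply: Ka; rewrite !inE eqxx !orbT.
Qed.

Theorem presentation_depth_cofactor : noetherian R ->
  presentation_matrix M <->
  depth_ge J 3 /\ exists2 u : R, u \is a GRing.unit
    & cofactor_mx M = u *: \matrix_(i, j) (g 0 i * h 0 j).
Proof.
move=> noethR; split=> [/presentation_matrixP exactM|[depthJ [u u_unit cofM]]].
  split; first exact: exact_depth_ge3.
  have [a aE] := cofactor_rank_one rkM prim_g prim_h gM hM.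
  exists a; first exact: (cofactor_factor_unit prim_g exactM aE).
  by apply/matrixP => i j; rewrite !mxE aE.
apply/presentation_matrixP; apply: depth_ge3_exact u_unit _ depthJ => i j.
by have /matrixP/(_ i j) := cofM; rewrite !mxE.
Qed.

End Presentation.

Theorem theorem2p8 (k : fieldType) (r n : nat) (hr : (3 <= r)%N)
    (hn : (3 <= n)%N) (M : 'M[{mpoly k[r]}]_n) (hM : frac_rank M = n.-1)
    (g h : 'rV[{mpoly k[r]}]_n) (hg : is_gamma M g) (hh : is_gamma M^T h) :
  presentation_matrix M <->
  depth_ge (gen_ideal [seq h 0 j | j <- enum 'I_n]) 3 /\
  exists2 u : {mpoly k[r]}, u \is a GRing.unit
    & cofactor_mx M = u *: \matrix_(i, j) (g 0 i * h 0 j).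
Proof.
case: n hn M hM g h hg hh => [//|m] _ M rkM g h gamma_g gamma_h.
have gcds := @mpoly_has_gcds k r.
have [prim_g gM] := is_gamma_kernel gcds rkM gamma_g.
have [|prim_h hM] := is_gamma_kernel gcds _ gamma_h; first by rewrite frac_rank_trmx.
exact: presentation_depth_cofactor (@mpoly_noetherian k r).
Qed.
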